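(* Let $\mathbb{K}$ be an algebraically closed field of characteristic zero. (a) Let $A$ be a commutative associative $\mathbb{K}$-algebra (of finite Krull dimension), let $R:A\to A$ be a linear map and let $D:A\to A$ be a twisted derivation with respect to $R$. Define a bilinear map $[\cdot,\cdot]_R:A\times A\to A$ by $$[f,g]_R=f\,D(g)-R(g)\,D(f),\qquad f,g\in A.$$ Then $(A,[\cdot,\cdot]_R)$ is a left-Alia algebra. (b) Let $V$ be a finite-dimensional $\mathbb{K}$-vector space and let $R$ be a pseudo-reflection on $V$. Then $R$ induces a left-Alia algebra $(\mathbb{K}[V],[\cdot,\cdot]_R)$, where $$[f,g]_R=f\,D_R(g)-R(g)\,D_R(f),\qquad f,g\in\mathbb{K}[V],$$ with $R:\mathbb{K}[V]\to\mathbb{K}[V]$ and the twisted derivation $D_R:\mathbb{K}[V]\to\mathbb{K}[V]$ induced by the pseudo-reflection $R$ as described in the context.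
   Context: A left-Alia algebra is a $\mathbb{K}$-vector space $A$ with a bilinear map $[\cdot,\cdot]:A\times A\to A$ such that for all $x,y,z\in A$: $[[x,y],z]+[[y,z],x]+[[z,x],y]=[[y,x],z]+[[z,y],x]+[[x,z],y]$. Given a commutative associative algebra $A$ and a linear map $R:A\to A$, a linear map $D:A\to A$ is a twisted derivation with respect to $R$ if $D(fg)=D(f)g+R(f)D(g)$ for all $f,g\in A$. A linear automorphism $R$ of $V$ is a pseudo-reflection if $R^m=I$ for some positive integer $m$ and $\mathrm{Im}(I-R)$ is one-dimensional. It induces an automorphism of $V^*$, also denoted $R$, by $R(x)(v)=x(R^{-1}v)$ for $x\in V^*$, $v\in V$; this is again a pseudo-reflection. The coordinate ring $\mathbb{K}[V]=\mathbb{K}[x_1,\dots,x_n]$ is the polynomial algebra on a basis $x_1,\dots,x_n$ of $V^*$, and $R:\mathbb{K}[V]\to\mathbb{K}[V]$ denotes the unique $\mathbb{K}$-algebra homomorphism extending $R:V^*\to V^*$. Fix a non-zero $l_R\in\mathrm{Im}(I-R)\subset V^*$. The map $D_R:\mathbb{K}[V]\to\mathbb{K}[V]$ is the (unique) linear map with $R(f)=f-D_R(f)\,l_R$ for all $f\in\mathbb{K}[V]$; it is a twisted derivation with respect to $R$. *)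

(* Defs.v *)
From HB Require Import structures.
From mathcomp Require Import all_boot all_order all_algebra.
From mathcomp Require Export mpoly.

Set Implicit Arguments.
Unset Strict Implicit.
Unset Printing Implicit Defensive.

Import GRing.Theory.
Local Open Scope ring_scope.

(* [comAlgType K] forces a nonzero algebra with unit.  To impose neither, a
   commutative associative algebra is a K-vector space together with a bilinear
   product [mul]; for a [comAlgType K] one takes [mul] to be [*%R]. *)
Section Algebras.
Variables (K : fieldType) (A : lmodType K).
Implicit Types (mul br : A -> A -> A) (R D : A -> A) (P Q : A -> Prop).

Definition left_Alia br : Prop :=
  bilinear_for *:%R *:%R br /\
  forall x y z : A,
    br (br x y) z + br (br y z) x + br (br z x) y =
    br (br y x) z + br (br z y) x + br (br x z) y.

Definition twisted_derivation mul R D : Prop :=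
  forall f g : A, D (mul f g) = mul (D f) g + mul (R f) (D g).

Definition twisted_bracket mul R D (f g : A) : A :=
  mul f (D g) - mul (R g) (D f).

Definition prime_ideal mul P : Prop :=
  [/\ P 0 /\ (forall (c : K) (u v : A), P u -> P v -> P (c *: u + v)),
      forall a u : A, P u -> P (mul a u) /\ P (mul u a),
      exists a : A, ~ P a
    & forall u v : A, P (mul u v) -> P u \/ P v].

Definition strictly_included P Q : Prop :=
  (forall a : A, P a -> Q a) /\ (exists a : A, Q a /\ ~ P a).

(* Some d bounds the length of all chains of primes P_0 < P_1 < ... < P_k:
   there is no chain of length d + 1. *)
Definition finite_Krull_dim mul : Prop :=
  exists d : nat, forall P : nat -> A -> Prop,
    ~ ((forall i : nat, (i <= d.+1)%N -> prime_ideal mul (P i)) /\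
       (forall i : nat, (i < d.+1)%N -> strictly_included (P i) (P i.+1))).

End Algebras.

Section PseudoReflections.
Variables (K : fieldType) (V : vectType K).

Definition pseudo_reflection (R : 'End(V)) : Prop :=
  [/\ lker R == 0%VS,
      exists2 m : nat, (0 < m)%N & forall v : V, iter m R v = v
    & \dim (limg (\1%VF - R)) = 1%N].

Definition dual_act (R : 'End(V)) (x : 'Hom(V, K^o)) : 'Hom(V, K^o) :=
  (x \o R^-1)%VF.

(* The coordinate ring K[V] is {mpoly K[n]}, the variable 'X_i standing for the
   i-th vector of a basis X of the dual of V. *)
Variables (n : nat) (X : n.-tuple 'Hom(V, K^o)).

Definition form_poly (x : 'Hom(V, K^o)) : {mpoly K[n]} :=
  \sum_(i < n) coord X i x *: 'X_i.

Definition poly_act (R : 'End(V)) (f : {mpoly K[n]}) : {mpoly K[n]} :=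
  f \mPo [tuple form_poly (dual_act R (tnth X i)) | i < n].

Lemma form_poly_basis (i : 'I_n) :
  basis_of fullv X -> form_poly (tnth X i) = 'X_i.
Proof.
move=> Xb; rewrite /form_poly (tnth_nth 0) (bigD1 i) //=.
rewrite coord_free ?(basis_free Xb) // eqxx scale1r big1 ?addr0 // => j ji.
rewrite coord_free ?(basis_free Xb) // eq_sym.
by rewrite (negPf ji) scale0r.
Qed.

(* [poly_act R] is the unique K-algebra endomorphism of K[V] extending the
   action of R on the dual of V. *)
Lemma poly_act_form (R : 'End(V)) (x : 'Hom(V, K^o)) :
  basis_of fullv X ->
  poly_act R (form_poly x) = form_poly (dual_act R x).
Proof.
move=> Xb; rewrite /poly_act {1}/form_poly linear_sum /=.
have -> : dual_act R x =
    \sum_(i < n) coord X i x *: dual_act R (tnth X i).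
  rewrite {1}(coord_basis Xb (memvf x)); apply/lfunP => v.
  rewrite /dual_act comp_lfunE !sum_lfunE; apply: eq_bigr => i _.
  by rewrite !lfunE /= !lfunE /= (tnth_nth 0).
rewrite [RHS]/form_poly.
under [RHS]eq_bigr do rewrite linear_sum scaler_suml.
rewrite exchange_big; apply: eq_bigr => i _ /=.
rewrite comp_mpolyZ comp_mpolyXU (nth_map i) ?size_enum_ord // nth_ord_enum.
by rewrite scaler_sumr; apply: eq_bigr => j _; rewrite scalerA [in RHS]linearZ.
Qed.

Lemma poly_act_unique (R : 'End(V))
    (S : {lrmorphism {mpoly K[n]} -> {mpoly K[n]}}) :
  basis_of fullv X ->
  (forall x, S (form_poly x) = form_poly (dual_act R x)) ->
  S =1 poly_act R.
Proof.
move=> Xb SX f; rewrite {1}(mpolyE f) /poly_act comp_mpolyE linear_sum /=.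
apply: eq_bigr => m _; rewrite linearZ /= mpolyXE_id rmorph_prod.
congr (_ *: _); apply: eq_bigr => i _.
by rewrite rmorphXn /= -(form_poly_basis i Xb) SX tnth_mktuple.
Qed.

End PseudoReflections.

(* Main.v *)
Require Import Defs.
From HB Require Import structures.
From mathcomp Require Import all_boot all_order all_algebra.

Set Implicit Arguments.
Unset Strict Implicit.
Unset Printing Implicit Defensive.

Import GRing.Theory.
Local Open Scope ring_scope.

(* For (a), the commutator of the bracket is twice the Wronskian
   w(f, g) = f D(g) - g D(f), and D w(f, g) = R(f) D^2(g) - R(g) D^2(f), so the
   cyclic sum of [w(x, y), z] telescopes.  For (b), I - R has rank one on the
   dual of V, so l_R divides x - R(x) for all linear forms x; as
   f g - R(f g) = (f - R(f)) g + R(f) (g - R(g)), it divides f - R(f) for all f,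
   and cancelling it in this identity shows that the quotient is a twisted
   derivation. *)

Section TwistedBracket.
Variables (K : fieldType) (A : lmodType K) (mul : {bilinear A -> A -> A}).
Variables R D : {linear A -> A}.
Hypotheses (mulA : associative mul) (mulC : commutative mul).
Hypothesis derD : twisted_derivation mul R D.

Local Notation br := (twisted_bracket mul R D).
Local Notation wronskian f g := (mul f (D g) - mul g (D f)).

Lemma twisted_bracket_bilinear : bilinear_for *:%R *:%R br.
Proof.
split=> [g|f] c u v; rewrite /twisted_bracket !linearP linearPl /=.
  by rewrite scalerBr -scalerN addrACA.
by rewrite scalerBr opprD addrACA.
Qed.

HB.instance Definition _ :=
  bilinear_isBilinear.Build K A A A *:%R *:%R br twisted_bracket_bilinear.

(* The two sides agree because D (f g) = D (g f). *)
Lemma wronskian_twist f g :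
  wronskian f g = mul (R f) (D g) - mul (R g) (D f).
Proof.
have := derD f g; rewrite mulC derD => E.
apply/eqP; rewrite subr_eq addrAC eq_sym subr_eq.
by rewrite [mul g _]mulC [mul f _]mulC E addrC.
Qed.

(** The two terms of the commutator that contain [R] form a second copy of the Wronskian, by
    [wronskian_twist]. *)
Lemma twisted_bracket_antisym f g : br f g - br g f = wronskian f g *+ 2.
Proof.
rewrite mulr2n {2}wronskian_twist /br /twisted_bracket.
by rewrite opprB addrACA [RHS]addrACA; congr (_ + _); rewrite addrC.
Qed.

(** Both products contribute [mul (D f) (D g)], with opposite signs, so only the terms with [D]
    applied twice survive. *)
Lemma der_wronskian f g :
  D (wronskian f g) = mul (R f) (D (D g)) - mul (R g) (D (D f)).
Proof.
rewrite linearB /= !derD [mul (D g) _]mulC opprD addrACA.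
by rewrite subrr add0r.
Qed.

(* Each summand has the form F a b c - F b c a, so the cyclic sum telescopes. *)
Lemma wronskian_jacobi x y z :
  br (wronskian x y) z + br (wronskian y z) x + br (wronskian z x) y = 0.
Proof.
pose F a b c :=
  mul (mul a (D b)) (D c) + mul (mul (R b) (R c)) (D (D a)).
have brE a b c : br (wronskian a b) c = F a b c - F b c a.
  rewrite /twisted_bracket der_wronskian linearBl linearBr /= !mulA.
  have mulAC u v w : mul (mul u v) w = mul (mul u w) v.
    by rewrite -mulA [mul v w]mulC mulA.
  rewrite /F (mulAC b) (mulC (R c) (R b)) opprB opprD.
  by rewrite addrACA.
by rewrite !brE subrKA subrKA subrr.
Qed.

Lemma twisted_bracket_left_Alia : left_Alia br.
Proof.
split=> [|x y z]; first exact: twisted_bracket_bilinear.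
have brB u v w : br u w - br v w = br (u - v) w by rewrite linearBl.
(* Pairing each term with its swapped counterpart turns the difference of the two sides into a
   cyclic sum of brackets of commutators, that is, of doubled Wronskians. *)
apply: subr0_eq; rewrite 2!opprD addrACA [X in X + _]addrACA !brB.
rewrite !twisted_bracket_antisym !linearMnl -!mulrnDl wronskian_jacobi.
by rewrite mul0rn.
Qed.

End TwistedBracket.

(** This lets the result on abstract products be applied with [*%R] on [{mpoly K[n]}]. *)
Lemma mpoly_mul_bilinear (K : fieldType) n :
  bilinear_for *:%R *:%R (@GRing.mul {mpoly K[n]}).
Proof.
split=> p c u v; first by rewrite mulrDl -scalerAl.
by rewrite mulrDr -scalerAr.
Qed.

HB.instance Definition _ (K : fieldType) n :=
  bilinear_isBilinear.Build K {mpoly K[n]} {mpoly K[n]} {mpoly K[n]}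
    *:%R *:%R *%R (mpoly_mul_bilinear K n).

Section PseudoReflection.
Variables (K : fieldType) (V : vectType K) (R : 'End(V)).
Hypothesis Rrefl : pseudo_reflection R.

Lemma pseudo_reflection_line :
  exists2 w : V, w != 0 & forall v, exists c : K, v - R v = c *: w.
Proof.
case: Rrefl => _ _ dimR; set U := limg _ in dimR.
have w0 : vpick U != 0 by rewrite vpick0 -dimv_eq0 dimR.
exists (vpick U) => // v; apply/vlineP.
have -> : <[vpick U]>%VS = U.
  by apply/eqP; rewrite eqEdim -memvE memv_pick dim_vline w0 dimR.
have -> : v - R v = (\1%VF - R)%VF v by rewrite !lfunE /= !lfunE.
exact: memv_img (memvf v).
Qed.

(** If [w] spans the image of [I - R], then [(z - dual_act R z) v] is [z w] times a scalar depending
    on [v] alone. All these forms are thus proportional; with [l] coming from [y], the ratio is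
    [x w / y w]. *)
Lemma dual_reflection_line (l : 'Hom(V, K^o)) :
  l != 0 -> (exists x, l = x - dual_act R x) ->
  forall x : 'Hom(V, K^o), exists c : K, x - dual_act R x = c *: l.
Proof.
move=> l0 [y ly] x; have [w _ Rw] := pseudo_reflection_line.
have [kerR _ _] := Rrefl.
have eval v : exists c : K,
    forall z : 'Hom(V, K^o), (z - dual_act R z) v = c * z w.
  (* At [R^-1 v] the line property reads [R^-1 v - v = c *: w], hence the sign in [- c]. *)
  have [c vc] := Rw ((R^-1)%VF v); exists (- c) => z.
  rewrite lfunE /= lfunE /= comp_lfunE -linearB /=.
  by rewrite -{1}[v](lker0_lfunVK kerR) -opprB linearN /= vc linearZ mulNr.
have yw : y w != 0.
  apply: contraNneq l0 => yw; apply/eqP/lfunP=> v.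
  by have [c ec] := eval v; rewrite ly ec yw mulr0 lfunE.
exists (x w / y w); apply/lfunP=> v; rewrite [RHS]lfunE /= ly.
have [c ec] := eval v; rewrite !ec.
by rewrite [RHS]mulrCA divfK.
Qed.

End PseudoReflection.

Section InducedDerivation.
Variables (K : fieldType) (V : vectType K) (R : 'End(V)).
Variables (n : nat) (X : n.-tuple 'Hom(V, K^o)).
Hypothesis Xbasis : basis_of fullv X.

Lemma form_poly_linear : linear (form_poly X).
Proof.
move=> c x y; rewrite scaler_sumr -big_split; apply: eq_bigr => i _ /=.
by rewrite linearP scalerDl scalerA.
Qed.

HB.instance Definition _ := GRing.isLinear.Build K 'Hom(V, K^o) {mpoly K[n]}
  _ (form_poly X) form_poly_linear.

(** The coefficient of ['X_i] is the [i]-th coordinate of [x] in the basis [X]. This makes [L]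
    nonzero, hence cancellable in the domain [{mpoly K[n]}]. *)
Lemma form_poly_eq0 x : (form_poly X x == 0) = (x == 0).
Proof.
apply/eqP/eqP=> [x0|->]; last exact: linear0.
rewrite (coord_basis Xbasis (memvf x)) big1 // => i _.
suff -> : coord X i x = 0 by rewrite scale0r.
have /(congr1 (mcoeff U_(i))) := x0.
rewrite mcoeff0 raddf_sum /= (bigD1 i) //= mcoeffZ mcoeffX eqxx mulr1.
rewrite big1 ?addr0 // => j ji.
by rewrite mcoeffZ mcoeffX eq_mnm1 (negPf ji) mulr0.
Qed.

Lemma poly_act_linear : linear (poly_act X R).
Proof. by move=> c f g; rewrite /poly_act linearP. Qed.

Lemma poly_act_monoid_morphism : monoid_morphism (poly_act X R).
Proof. by rewrite /poly_act; split=> [|f g]; rewrite ?rmorph1 ?rmorphM. Qed.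

HB.instance Definition _ := GRing.isLinear.Build K {mpoly K[n]} {mpoly K[n]}
  _ (poly_act X R) poly_act_linear.
HB.instance Definition _ := GRing.isMonoidMorphism.Build
  {mpoly K[n]} {mpoly K[n]} (poly_act X R) poly_act_monoid_morphism.

Variable l : 'Hom(V, K^o).
Hypothesis imR : forall x, exists c : K, x - dual_act R x = c *: l.

Let L := form_poly X l.

(** The boolean equality allows the quotient to be extracted with [xchoose]. *)
Lemma poly_act_divisible f : exists q, f - poly_act X R f == q * L.
Proof.
have divM g h : (exists q, g - poly_act X R g == q * L) ->
    (exists q, h - poly_act X R h == q * L) ->
    exists q, g * h - poly_act X R (g * h) == q * L.
  move=> [p /eqP gp] [q /eqP hq]; exists (p * h + poly_act X R g * q).
  by rewrite mulrDl mulrAC -gp -mulrA -hq rmorphM mulrBl mulrBr addrA subrK.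
have div1 : exists q, 1 - poly_act X R 1 == q * L.
  by exists 0; rewrite rmorph1 subrr mul0r.
elim/mpolyind: f => [|c m p _ _ [q /eqP pq]].
  by exists 0; rewrite linear0 subrr mul0r.
(* A monomial is a product of powers of variables, so [divM] and [div1] reduce the claim to a single
   variable. *)
have [r /eqP mr] : exists r, 'X_[m] - poly_act X R 'X_[m] == r * L.
  rewrite mpolyXE_id.
  apply: (big_ind (fun f => exists r, f - poly_act X R f == r * L)) => // i _.
  elim: (m i) => [|k IHk]; first by rewrite expr0.
  rewrite exprS; apply: divM => //.
  (* For a variable the quotient is the constant given by the rank-one property on the dual. *)
  have [b xb] := imR (tnth X i); exists b%:MP.
  by rewrite -(form_poly_basis i Xbasis) poly_act_form // -linearB xb linearZ
    mul_mpolyC.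
exists (c *: r + q).
by rewrite linearP mulrDl -pq -scalerAl -mr scalerBr opprD addrACA.
Qed.

Hypothesis l0 : l != 0.

Lemma form_poly_mulIr : injective ( *%R^~ L).
Proof. by apply: mulIf; rewrite form_poly_eq0. Qed.

(** The chosen quotient is linear because [D f * L] is linear in [f] and [L] cancels. *)
Lemma reflection_der_exists :
  exists D : {linear {mpoly K[n]} -> {mpoly K[n]}},
    forall f, poly_act X R f = f - D f * L.
Proof.
pose D f := xchoose (poly_act_divisible f).
have DE f : D f * L = f - poly_act X R f.
  by rewrite -(eqP (xchooseP (poly_act_divisible f))).
have D_linear : linear D.
  move=> c f g; apply: form_poly_mulIr; rewrite /= mulrDl -scalerAl.
  by rewrite !DE linearP scalerBr opprD addrACA.
pose DlinearM := GRing.isLinear.Build K {mpoly K[n]} {mpoly K[n]} _ D D_linear.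
pose Dlin : {linear {mpoly K[n]} -> {mpoly K[n]}} := HB.pack D DlinearM.
by exists Dlin => f; rewrite /= DE opprB addrC subrK.
Qed.

Lemma reflection_der_unique (D D' : {mpoly K[n]} -> {mpoly K[n]}) :
  (forall f, poly_act X R f = f - D f * L) ->
  (forall f, poly_act X R f = f - D' f * L) -> D' =1 D.
Proof.
move=> DE D'E f; apply/form_poly_mulIr/oppr_inj/(addrI f).
by rewrite -DE -D'E.
Qed.

Lemma reflection_der_twisted (D : {mpoly K[n]} -> {mpoly K[n]}) :
  (forall f, poly_act X R f = f - D f * L) ->
  twisted_derivation *%R (poly_act X R) D.
Proof.
move=> RE f g; have DE h : D h * L = h - poly_act X R h.
  by rewrite RE opprB addrC subrK.
apply: form_poly_mulIr; rewrite /= mulrDl mulrAC -(mulrA _ _ L).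
by rewrite !DE rmorphM mulrBl mulrBr addrA subrK.
Qed.

End InducedDerivation.

Theorem theoremA (K : closedFieldType) (K_char0 : [pchar K] =i pred0) :
  (forall (A : lmodType K) (mul : {bilinear A -> A -> A})
      (R D : {linear A -> A}),
    associative mul -> commutative mul -> finite_Krull_dim mul ->
    twisted_derivation mul R D ->
    left_Alia (twisted_bracket mul R D))
  /\
  (forall (V : vectType K) (R : 'End(V)),
    pseudo_reflection R ->
    forall (n : nat) (X : n.-tuple 'Hom(V, K^o)),
    basis_of fullv X ->
    forall l : 'Hom(V, K^o),
    l != 0 -> (exists x : 'Hom(V, K^o), l = x - dual_act R x) ->
    exists D : {linear {mpoly K[n]} -> {mpoly K[n]}},
      [/\ forall f, poly_act X R f = f - D f * form_poly X l,
          forall D' : {linear {mpoly K[n]} -> {mpoly K[n]}},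
            (forall f, poly_act X R f = f - D' f * form_poly X l) -> D' =1 D,
          twisted_derivation *%R (poly_act X R) D
        & left_Alia (twisted_bracket *%R (poly_act X R) D)]).
Proof.
split=> [A mul R D mulA mulC _ derD | V R Rrefl n X Xbasis l l0 lR].
  exact: twisted_bracket_left_Alia.
have imR := dual_reflection_line Rrefl l0 lR.
have [D DE] := reflection_der_exists Xbasis imR l0.
have derD := reflection_der_twisted Xbasis l0 DE.
exists D; split=> //.
  by move=> D' D'E; apply: reflection_der_unique D'E.
exact: twisted_bracket_left_Alia (@mulrA _) (@mulrC _) derD.
Qed.
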